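(* Let $SO(2)$ be the group of rotations about the axis $\mathbf{e}_3$. A quadratic form $\phi$ in the 21 elastic moduli is invariant under $SO(2)$ if and only if it is of the form $\phi=c^tFc$, where the $21\times 21$ symmetric matrix $F$ is $F=F^{(1)}+F^{(2)}$ with $$F^{(1)}=\begin{pmatrix} A_{9\times 9}&0_{9\times 12}\\ 0_{12\times 9}&B^{(1)}_{12\times 12}\end{pmatrix},\qquad F^{(2)}=\begin{pmatrix} 0_{9\times 9}&D_{9\times 12}\\ D^t_{12\times 9}&B^{(2)}_{12\times 12}\end{pmatrix},$$ where $F^{(1)}$ and $F^{(2)}$ range over subspaces of dimension 29 and 6 respectively, and the symmetric matrices $A$, $B^{(1)}$, $B^{(2)}$ and the matrix $D$ are defined by 27, 17, 3 and 3 elements respectively, as follows (for symmetric matrices only the upper triangle is displayed). $$A=\left(\begin{array}{ccccccccc} f_{11}&f_{12}&f_{13}&f_{14}&f_{15}&f_{16}&f_{17}&f_{18}&f_{19}\\ &f_{11}&f_{13}&f_{15}&f_{14}&f_{16}&f_{18}&f_{17}&f_{19}\\ &&f_{33}&f_{34}&f_{34}&f_{36}&f_{37}&f_{37}&f_{39}\\ &&&f_{44}&f_{45}&f_{46}&f_{47}&f_{48}&f_{49}\\ &&&&f_{44}&f_{46}&f_{48}&f_{47}&f_{49}\\ &&&&&f_{66}&f_{67}&f_{67}&f_{69}\\ &&&&&&f_{77}&f_{78}&f_{79}\\ &&&&&&&f_{77}&f_{79}\\ &&&&&&&&f_{99} \end{array}\right),$$ $$B^{(1)}=\left(\begin{array}{cccccccccccc}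 b_{11}&0&0&b_{14}&0&0&b_{17}&0&0&b_{1,10}&0&0\\ &b_{11}&0&0&b_{17}&0&0&b_{14}&0&0&b_{1,10}&0\\ &&b_{33}&0&0&b_{36}&0&0&b_{36}&0&0&b_{3,12}\\ &&&b_{44}&0&0&b_{47}&0&0&b_{4,10}&0&0\\ &&&&b_{55}&0&0&b_{47}&0&0&b_{5,11}&0\\ &&&&&b_{66}&0&0&b_{69}&0&0&b_{6,12}\\ &&&&&&b_{55}&0&0&b_{5,11}&0&0\\ &&&&&&&b_{44}&0&0&b_{4,10}&0\\ &&&&&&&&b_{66}&0&0&b_{6,12}\\ &&&&&&&&&b_{10,10}&0&0\\ &&&&&&&&&&b_{10,10}&0\\ &&&&&&&&&&&b_{12,12} \end{array}\right).$$ The elements $f_{33},f_{34},f_{37}$ of $A$ and $b_{44}$ of $B^{(1)}$ are arbitrary real numbers, while the remaining 40 distinct elements in $A$ and $B^{(1)}$ are arbitrary as long as they satisfy the 15 linearly independent conditions $$\begin{aligned} 2f_{11}+2f_{12}-4f_{16}+f_{66}-f_{99}&=0,\\ 2f_{11}+2f_{12}-2f_{19}-f_{66}-f_{69}&=0,\\ 2f_{13}-f_{36}-f_{39}&=0,\\ f_{14}+f_{15}-f_{46}-f_{49}&=0,\\ f_{17}+f_{18}-f_{67}-f_{79}&=0,\\ 2f_{44}-2f_{45}-b_{33}&=0,\\ 2f_{14}-2f_{15}+b_{36}&=0,\\ 2f_{47}-2f_{48}-b_{3,12}&=0,\\ 4f_{11}-2f_{16}-2f_{19}-b_{66}&=0,\\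 4f_{12}-2f_{16}-2f_{19}+b_{69}&=0,\\ 2f_{17}-2f_{18}+b_{6,12}&=0,\\ 2f_{77}-2f_{78}-b_{12,12}&=0,\\ b_{14}-b_{47}+b_{4,10}&=0,\\ b_{11}-2b_{17}+b_{55}-b_{10,10}&=0,\\ b_{11}+b_{1,10}-b_{55}+b_{5,11}&=0. \end{aligned}$$ Also $$B^{(2)}=\left(\begin{array}{cccccccccccc} 0&0&0&0&b_{15}&0&0&b_{18}&0&0&b_{15}&0\\ &0&0&-b_{18}&0&0&-b_{15}&0&0&-b_{15}&0&0\\ &&0&0&0&0&0&0&0&0&0&0\\ &&&0&b_{45}&0&0&0&0&0&b_{18}+b_{45}&0\\ &&&&0&0&0&0&0&-b_{15}&0&0\\ &&&&&0&0&0&0&0&0&0\\ &&&&&&0&-b_{45}&0&0&b_{15}&0\\ &&&&&&&0&0&-b_{18}-b_{45}&0&0\\ &&&&&&&&0&0&0&0\\ &&&&&&&&&0&0&0\\ &&&&&&&&&&0&0\\ &&&&&&&&&&&0 \end{array}\right),$$ $$D=\left(\begin{array}{cccccccccccc} 0&0&d_{13}&0&0&0&0&0&0&0&0&d_{1,12}\\ 0&0&-d_{13}&0&0&0&0&0&0&0&0&-d_{1,12}\\ 0&0&0&0&0&0&0&0&0&0&0&0\\ 0&0&0&0&0&d_{13}&0&0&d_{13}&0&0&d_{4,12}\\ 0&0&0&0&0&-d_{13}&0&0&-d_{13}&0&0&-d_{4,12}\\ 0&0&0&0&0&0&0&0&0&0&0&0\\ 0&0&-d_{4,12}&0&0&d_{1,12}&0&0&d_{1,12}&0&0&0\\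 0&0&d_{4,12}&0&0&-d_{1,12}&0&0&-d_{1,12}&0&0&0\\ 0&0&0&0&0&0&0&0&0&0&0&0 \end{array}\right),$$ where the 6 elements $b_{15},b_{18},b_{45},d_{13},d_{1,12},d_{4,12}$ are arbitrary real numbers. The number of linearly independent quadratic invariants under $SO(2)$ is thirty-five; that is, the real vector space of $SO(2)$-invariant quadratic forms in the moduli has dimension 35.
   Context: Let $\mathbb{E}$ be the 21-dimensional real vector space of fourth-order tensors $(c_{ijkl})$, $i,j,k,l\in\{1,2,3\}$, with the symmetries $c_{ijkl}=c_{jikl}$ and $c_{ijkl}=c_{klij}$ (no positive-definiteness is imposed). An orthogonal matrix $Q\in O(3)$ acts on $\mathbb{E}$ by $c_{ijkl}\mapsto Q_{ip}Q_{jq}Q_{kr}Q_{ls}c_{pqrs}$ (summation over repeated indices). A quadratic invariant under a group $G\subseteq O(3)$ is a real quadratic form $\phi$ on $\mathbb{E}$ with $\phi(Q\cdot C)=\phi(C)$ for all $Q\in G$, $C\in\mathbb{E}$. Here $\mathbf{e}_1,\mathbf{e}_2,\mathbf{e}_3$ is the orthonormal basis to which the components refer. Voigt notation: $c_{IJ}=c_{ijkl}$ with $I=1,2,3,4,5,6$ corresponding to $ij=11,22,33,23,31,12$ (and likewise $J$ to $kl$), so $c_{IJ}=c_{JI}$. The 21-vector of elastic moduli (in this order) is $$c=(c_{11},c_{22},c_{33},c_{23},c_{13},c_{12},c_{44},c_{55},c_{66},c_{14},c_{25},c_{36},c_{34},c_{15},c_{26},c_{24},c_{35},c_{16},c_{56},c_{46},c_{45})^t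 .$$ The rows and columns of $A$ (and the rows of $D$) correspond to the first 9 components of $c$; the rows and columns of $B^{(1)},B^{(2)}$ (and the columns of $D$) correspond to the last 12 components. *)

(* Defs.v *)
From HB Require Import structures.
From mathcomp Require Import all_boot all_order all_algebra.
From mathcomp Require Import boolp classical_sets functions reals.

Set Implicit Arguments.
Unset Strict Implicit.
Unset Printing Implicit Defensive.

Import Order.TTheory GRing.Theory Num.Theory.

Local Open Scope classical_set_scope.
Local Open Scope ring_scope.

(* Tensor indices 1, 2, 3 are the ordinals 0, 1, 2. *)
Definition i1 : 'I_3 := @Ordinal 3 0 isT.
Definition i2 : 'I_3 := @Ordinal 3 1 isT.
Definition i3 : 'I_3 := @Ordinal 3 2 isT.

Definition tensor4 (R : realType) :=
  {ffun 'I_3 * 'I_3 * 'I_3 * 'I_3 -> R^o}.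

Definition elastic_sym (R : realType) : {pred tensor4 R} := fun C =>
  [forall i, forall j, forall k, forall l,
     (C (i, j, k, l) == C (j, i, k, l)) && (C (i, j, k, l) == C (k, l, i, j))].
Arguments elastic_sym {R}.

Lemma elastic_symP (R : realType) (C : tensor4 R) :
  reflect (forall i j k l, C (i, j, k, l) = C (j, i, k, l)
                        /\ C (i, j, k, l) = C (k, l, i, j))
          (C \in elastic_sym).
Proof.
apply: (iffP forallP) => [h i j k l|h i].
  by move/forallP/(_ j)/forallP/(_ k)/forallP/(_ l)/andP: (h i) => [/eqP ? /eqP].
apply/forallP => j; apply/forallP => k; apply/forallP => l.
by have [h1 h2] := h i j k l; apply/andP; split; apply/eqP.
Qed.

Fact elastic_sym_submod (R : realType) : submod_closed (@elastic_sym R).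
Proof.
split=> [|a C D /elastic_symP hC /elastic_symP hD].
  by apply/elastic_symP => i j k l; rewrite !ffunE.
apply/elastic_symP => i j k l; rewrite !ffunE.
have [h1 h2] := hC i j k l; have [h3 h4] := hD i j k l.
by split; [rewrite h1 h3 | rewrite h2 h4].
Qed.

HB.instance Definition _ (R : realType) :=
  GRing.isSubmodClosed.Build R (tensor4 R) elastic_sym (elastic_sym_submod R).

Record elasticity (R : realType) := Elasticity {
  elasticity_val :> tensor4 R;
  _ : elasticity_val \in elastic_sym }.

HB.instance Definition _ (R : realType) :=
  [isSub for @elasticity_val R].
HB.instance Definition _ (R : realType) :=
  [Choice of elasticity R by <:].
HB.instance Definition _ (R : realType) :=
  [SubChoice_isSubLmodule of elasticity R by <:].

Definition act_tensor (R : realType) (Q : 'M[R]_3) (C : tensor4 R) :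
    tensor4 R :=
  [ffun x : 'I_3 * 'I_3 * 'I_3 * 'I_3 => let: (i, j, k, l) := x in
     \sum_p \sum_q \sum_r \sum_s
       Q i p * Q j q * Q k r * Q l s * C (p, q, r, s)].

Fact act_elastic_sym (R : realType) (Q : 'M[R]_3) (C : elasticity R) :
  act_tensor Q C \in elastic_sym.
Proof.
have /elastic_symP hC := valP C.
apply/elastic_symP => i j k l; rewrite !ffunE; split.
  rewrite exchange_big /=; apply: eq_bigr => q _; apply: eq_bigr => p _.
  apply: eq_bigr => r _; apply: eq_bigr => s _.
  by have [-> _] := hC p q r s; rewrite (mulrC (Q i p)).
transitivity (\sum_r \sum_s \sum_p \sum_q
    Q i p * Q j q * Q k r * Q l s * (C : tensor4 R) (p, q, r, s)).
  under eq_bigr => p _ do rewrite exchange_big /=.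
  rewrite exchange_big /=; apply: eq_bigr => r _.
  under eq_bigr => p _ do rewrite exchange_big /=.
  by rewrite exchange_big.
apply: eq_bigr => r _; apply: eq_bigr => s _.
apply: eq_bigr => p _; apply: eq_bigr => q _.
have [_ ->] := hC p q r s; congr (_ * _).
by rewrite -[LHS]mulrA mulrC mulrA.
Qed.

Definition act (R : realType) (Q : 'M[R]_3) (C : elasticity R) :
    elasticity R :=
  Elasticity (act_elastic_sym Q C).

Definition O3 (R : realType) : set 'M[R]_3 := [set Q | Q *m Q^T = 1%:M].

Definition SO2 (R : realType) : set 'M[R]_3 :=
  [set Q | [/\ O3 Q, \det Q = 1 &
               Q *m delta_mx i3 0 = delta_mx i3 0 :> 'cV[R]_3]].

Definition quadratic_form (R : realType) (phi : elasticity R -> R^o) : Prop :=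
  exists b : {bilinear elasticity R -> elasticity R -> R^o},
    forall C, phi C = b C C.

Definition invariant_under (R : realType) (G : set 'M[R]_3)
    (phi : elasticity R -> R^o) : Prop :=
  forall Q C, G Q -> phi (act Q C) = phi C.

Definition quadratic_invariants (R : realType) (G : set 'M[R]_3) :
    set (elasticity R -> R^o) :=
  [set phi | quadratic_form phi /\ invariant_under G phi].

(* The pair ij abbreviated by the Voigt index I = 1, ..., 6. *)
Definition voigt (I : nat) : 'I_3 * 'I_3 :=
  nth (i1, i1)
    [:: (i1, i1); (i2, i2); (i3, i3); (i2, i3); (i3, i1); (i1, i2)] I.-1.

Definition modulus (R : realType) (C : elasticity R) (I J : nat) : R :=
  let: (i, j) := voigt I in let: (k, l) := voigt J in
  (C : tensor4 R) (i, j, k, l).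

Definition moduli (R : realType) (C : elasticity R) : 'cV[R]_(9 + 12) :=
  let c := modulus C in
  \col_n nth 0
    [:: c 1 1; c 2 2; c 3 3; c 2 3; c 1 3; c 1 2; c 4 4; c 5 5; c 6 6;
        c 1 4; c 2 5; c 3 6; c 3 4; c 1 5; c 2 6; c 2 4; c 3 5; c 1 6;
        c 5 6; c 4 6; c 4 5]%N n.

Definition rows_mx (R : realType) (m n : nat) (s : seq (seq R)) : 'M[R]_(m, n) :=
  \matrix_(i, j) nth 0 (nth [::] s i) j.

(* The symmetric matrix whose upper triangle has rows s; row i of s starts at
   the diagonal entry (i, i). *)
Definition sym_mx (R : realType) (n : nat) (s : seq (seq R)) : 'M[R]_n :=
  \matrix_(i, j) nth 0 (nth [::] s (minn i j)) (maxn i j - minn i j).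

(* The parameters f, b, d below are families indexed by all pairs of naturals;
   only the entries that are displayed matter. *)
Definition A_mx (R : realType) (f : nat -> nat -> R) : 'M[R]_9 :=
  sym_mx 9
  [:: [:: f 1 1; f 1 2; f 1 3; f 1 4; f 1 5; f 1 6; f 1 7; f 1 8; f 1 9];
              [:: f 1 1; f 1 3; f 1 5; f 1 4; f 1 6; f 1 8; f 1 7; f 1 9];
                      [:: f 3 3; f 3 4; f 3 4; f 3 6; f 3 7; f 3 7; f 3 9];
                              [:: f 4 4; f 4 5; f 4 6; f 4 7; f 4 8; f 4 9];
                                      [:: f 4 4; f 4 6; f 4 8; f 4 7; f 4 9];
                                              [:: f 6 6; f 6 7; f 6 7; f 6 9];
                                                      [:: f 7 7; f 7 8; f 7 9];
                                                              [:: f 7 7; f 7 9];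
                                                                      [:: f 9 9]]%N.

Definition B1_mx (R : realType) (b : nat -> nat -> R) : 'M[R]_12 :=
  let o : R := 0 in sym_mx 12
  [:: [:: b 1 1; o; o; b 1 4; o; o; b 1 7; o; o; b 1 10; o; o];
      [:: b 1 1; o; o; b 1 7; o; o; b 1 4; o; o; b 1 10; o];
      [:: b 3 3; o; o; b 3 6; o; o; b 3 6; o; o; b 3 12];
      [:: b 4 4; o; o; b 4 7; o; o; b 4 10; o; o];
      [:: b 5 5; o; o; b 4 7; o; o; b 5 11; o];
      [:: b 6 6; o; o; b 6 9; o; o; b 6 12];
      [:: b 5 5; o; o; b 5 11; o; o];
      [:: b 4 4; o; o; b 4 10; o];
      [:: b 6 6; o; o; b 6 12];
      [:: b 10 10; o; o];
      [:: b 10 10; o];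
      [:: b 12 12]]%N.

Definition B2_mx (R : realType) (b : nat -> nat -> R) : 'M[R]_12 :=
  let o : R := 0 in
  let b15 := b 1%N 5%N in let b18 := b 1%N 8%N in let b45 := b 4%N 5%N in
  sym_mx 12
  [:: [:: o; o; o; o; b15; o; o; b18; o; o; b15; o];
      [:: o; o; - b18; o; o; - b15; o; o; - b15; o; o];
      [:: o; o; o; o; o; o; o; o; o; o];
      [:: o; b45; o; o; o; o; o; b18 + b45; o];
      [:: o; o; o; o; o; - b15; o; o];
      [:: o; o; o; o; o; o; o];
      [:: o; - b45; o; o; b15; o];
      [:: o; o; - b18 - b45; o; o];
      [:: o; o; o; o];
      [:: o; o; o];
      [:: o; o];
      [:: o]].

Definition D_mx (R : realType) (d : nat -> nat -> R) : 'M[R]_(9, 12) :=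
  let o : R := 0 in
  let d13 := d 1%N 3%N in let d1_12 := d 1%N 12%N in let d4_12 := d 4%N 12%N in
  rows_mx 9 12
  [:: [:: o; o; d13; o; o; o; o; o; o; o; o; d1_12];
      [:: o; o; - d13; o; o; o; o; o; o; o; o; - d1_12];
      [:: o; o; o; o; o; o; o; o; o; o; o; o];
      [:: o; o; o; o; o; d13; o; o; d13; o; o; d4_12];
      [:: o; o; o; o; o; - d13; o; o; - d13; o; o; - d4_12];
      [:: o; o; o; o; o; o; o; o; o; o; o; o];
      [:: o; o; - d4_12; o; o; d1_12; o; o; d1_12; o; o; o];
      [:: o; o; d4_12; o; o; - d1_12; o; o; - d1_12; o; o; o];
      [:: o; o; o; o; o; o; o; o; o; o; o; o]].

Definition conditions (R : realType) (f b : nat -> nat -> R) : 'rV[R]_15 :=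
  let f i j := f i%N j%N in let b i j := b i%N j%N in
  \row_n nth 0
    [:: 2 * f 1 1 + 2 * f 1 2 - 4 * f 1 6 + f 6 6 - f 9 9;
        2 * f 1 1 + 2 * f 1 2 - 2 * f 1 9 - f 6 6 - f 6 9;
        2 * f 1 3 - f 3 6 - f 3 9;
        f 1 4 + f 1 5 - f 4 6 - f 4 9;
        f 1 7 + f 1 8 - f 6 7 - f 7 9;
        2 * f 4 4 - 2 * f 4 5 - b 3 3;
        2 * f 1 4 - 2 * f 1 5 + b 3 6;
        2 * f 4 7 - 2 * f 4 8 - b 3 12;
        4 * f 1 1 - 2 * f 1 6 - 2 * f 1 9 - b 6 6;
        4 * f 1 2 - 2 * f 1 6 - 2 * f 1 9 + b 6 9;
        2 * f 1 7 - 2 * f 1 8 + b 6 12;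
        2 * f 7 7 - 2 * f 7 8 - b 12 12;
        b 1 4 - b 4 7 + b 4 10;
        b 1 1 - 2 * b 1 7 + b 5 5 - b 10 10;
        b 1 1 + b 1 10 - b 5 5 + b 5 11] n.

Definition F1_family (R : realType) : set 'M[R]_(9 + 12) :=
  [set F | exists f b : nat -> nat -> R,
     conditions f b = 0 /\ F = block_mx (A_mx f) 0 0 (B1_mx b)].

Definition F2_family (R : realType) : set 'M[R]_(9 + 12) :=
  [set F | exists b d : nat -> nat -> R,
     F = block_mx 0 (D_mx d) (D_mx d)^T (B2_mx b)].

Definition has_dim (R : realType) (V : lmodType R) (S : set V) (n : nat) : Prop :=
  exists e : 'I_n -> V,
    (forall a : 'I_n -> R, \sum_i a i *: e i = 0 -> forall i, a i = 0) /\
    (forall v, S v <-> exists a : 'I_n -> R, v = \sum_i a i *: e i).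

(* Main.v *)
Require Import Defs.
From HB Require Import structures.
From mathcomp Require Import all_boot all_order all_algebra.
From mathcomp Require Import boolp classical_sets functions reals.
From mathcomp Require Import ring lra.

Set Implicit Arguments.
Unset Strict Implicit.
Unset Printing Implicit Defensive.

Import Order.TTheory GRing.Theory Num.Theory.

Local Open Scope classical_set_scope.
Local Open Scope ring_scope.

(* Evaluating C, seen as a quadratic form on symmetric matrices, on
   e1^2 + e2^2 and e3^2 (weight 0), e3 (e1 + i e2) (weight 1), (e1 + i e2)^2
   (weight 2) and their conjugates gives 13 coordinates w_j = wre j + i wim j,
   real for weight 0, and the rotation of angle t multiplies w_j by
   exp(i k_j t), where k_j = weight j takes the values 0, 1, 2, 3, 4 with
   multiplicities 5, 3, 3, 1, 1.  The invariant quadratic forms are therefore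
   the combinations of the Re (w_j conj w_l) and the Im (w_j conj w_l) with
   k_j = k_l.  The 15 + 6 + 6 + 1 + 1 = 29 real parts make up F1_family and the
   3 + 3 = 6 imaginary parts make up F2_family. *)

(** * Dimension counts for parametrised subspaces, and matrices given by lists of rows *)

Section Dimension.
Variable R : realType.

(** The images under [M] of the indicator functions of the elements of [s] form a basis. Only the
    values on [s] count, so [I] may be infinite, as it is for families indexed by all pairs of
    naturals. *)
Lemma has_dim_param (V : lmodType R) (I : eqType) (s : seq I)
    (M : (I -> R) -> V) (S : set V) :
  uniq s ->
  (forall a x y, M (fun i => a * x i + y i) = a *: M x + M y) ->
  (forall x, M x = 0 <-> {in s, forall i, x i = 0}) ->
  (forall v, S v <-> exists x, v = M x) ->
  has_dim S (size s).
Proof.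
move=> us linM M0 SM.
pose d k i : R := (i == tnth (in_tuple s) k)%:R.
have zeroM : M (fun=> 0) = 0 by apply/M0.
have sumM (a : 'I_(size s) -> R) (r : seq 'I_(size s)) :
    \sum_(k <- r) a k *: M (d k) = M (fun i => \sum_(k <- r) a k * d k i).
  elim: r => [|k r IH].
    by rewrite big_nil -[LHS]zeroM; congr M; apply: funext => i; rewrite big_nil.
  rewrite big_cons IH -linM; congr M.
  by apply: funext => i; rewrite big_cons.
have sum_d (a : 'I_(size s) -> R) l :
    \sum_k a k * d k (tnth (in_tuple s) l) = a l.
  rewrite (bigD1 l) //= /d eqxx mulr1 big1 ?addr0 // => k kl.
  rewrite (tnth_nth (tnth (in_tuple s) l)) [X in _ == X](tnth_nth (tnth (in_tuple s) l)).
  by rewrite nth_uniq //= eq_sym (inj_eq val_inj) (negPf kl) mulr0.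
exists (fun k => M (d k)); split=> [a|v].
  by rewrite sumM => /M0 a0 k; rewrite -(sum_d a k); apply/a0/mem_tnth.
rewrite SM; split=> [[x ->]|[a ->]]; last by rewrite sumM; eexists.
exists (x \o tnth (in_tuple s)); rewrite sumM; set y := fun i => _.
(* [y] is the combination of indicators with the values of [x] as coefficients. It agrees with [x]
   on [s], so [M] kills the difference. *)
have : M (fun i => -1 * y i + x i) = 0.
  apply/M0 => i si; have /tnthP[k ->] : i \in in_tuple s by [].
  by rewrite /y (sum_d (x \o tnth (in_tuple s))) mulN1r addNr.
by rewrite linM scaleN1r addrC => /subr0_eq.
Qed.

(** The second hypothesis combines two facts: the sum of [S1] and [S2] is direct, and [q] is
    injective on it. Hence the images of the two bases together form a basis. *)
Lemma has_dim_image_add (V W : lmodType R) (S1 S2 : set V) (S : set W)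
    (q : V -> W) (m n : nat) :
  (forall a u v, q (a *: u + v) = a *: q u + q v) ->
  (forall u v, S1 u -> S2 v -> q (u + v) = 0 -> u = 0 /\ v = 0) ->
  (forall w, S w <-> exists u v, [/\ S1 u, S2 v & w = q (u + v)]) ->
  has_dim S1 m -> has_dim S2 n -> has_dim S (m + n).
Proof.
move=> linq injq Sq [e [free_e span_e]] [f [free_f span_f]].
have q0 : q 0 = 0.
  by have := linq (-1) 0 0; rewrite scaler0 addr0 scaleN1r addNr.
have qD u v : q (u + v) = q u + q v by have := linq 1 u v; rewrite !scale1r.
have qsum k (a : 'I_k -> R) (u : 'I_k -> V) :
    q (\sum_i a i *: u i) = \sum_i a i *: q (u i).
  elim/big_rec2: _ => [|i y1 y2 _ IH]; first by rewrite q0.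
  by rewrite linq IH.
exists (fun k => match fintype.split k with inl i => q (e i) | inr j => q (f j) end).
have sumE (a : 'I_(m + n) -> R) :
    \sum_k a k *: match fintype.split k with inl i => q (e i) | inr j => q (f j) end
    = q (\sum_i a (lshift n i) *: e i + \sum_j a (rshift m j) *: f j).
  rewrite big_split_ord qD !qsum.
  by congr (_ + _); apply: eq_bigr => i _;
    [rewrite (unsplitK (inl i)) | rewrite (unsplitK (inr i))].
split=> [a|w].
  rewrite sumE => /injq[||/free_e ae /free_f af]; try by [apply/span_e; eexists|apply/span_f; eexists].
  by move=> k; rewrite -(splitK k); case: (fintype.split k) => i /=.
rewrite Sq; split=> [[u [v [/span_e[a ->] /span_f[b ->] ->]]]|[a ->]].
  exists (fun k => match fintype.split k with inl i => a i | inr j => b j end).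
  rewrite sumE; congr (q (_ + _)); apply: eq_bigr => i _.
    by rewrite (unsplitK (inl i)).
  by rewrite (unsplitK (inr i)).
rewrite sumE; do 2 eexists; split; last by [].
  by apply/span_e; eexists.
by apply/span_f; eexists.
Qed.

(** This computes on explicit tables, so that linearity of a displayed matrix reduces to identities
    between its listed entries. Since [zip] truncates, the lemmas below ask for equal shapes. *)
Definition lincomb (a : R) (s t : seq (seq R)) : seq (seq R) :=
  [seq [seq a * z.1 + z.2 | z <- zip p.1 p.2] | p <- zip s t].

Lemma nth_lincomb a s t i j : shape s = shape t ->
  nth 0 (nth [::] (lincomb a s t) i) j
  = a * nth 0 (nth [::] s i) j + nth 0 (nth [::] t i) j.
Proof.
elim: s t i => [|r s IH] [|r' t] //= i.
  by rewrite /lincomb /= !nth_nil mulr0 addr0.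
case=> rr' st; case: i => [|i]; last exact: IH.
rewrite /lincomb /=; elim: r r' j {IH} rr' => [|x r IHr] [|x' r'] //= j.
  by rewrite !nth_nil mulr0 addr0.
by case=> rr'; case: j => //= j; apply: IHr.
Qed.

Lemma sym_mx_lin n a s t : shape s = shape t ->
  sym_mx n (lincomb a s t) = a *: sym_mx n s + sym_mx n t.
Proof. by move=> st; apply/matrixP => i j; rewrite !mxE nth_lincomb. Qed.

Lemma rows_mx_lin m n a s t : shape s = shape t ->
  rows_mx m n (lincomb a s t) = a *: rows_mx m n s + rows_mx m n t.
Proof. by move=> st; apply/matrixP => i j; rewrite !mxE nth_lincomb. Qed.

Lemma all_rows_eq0 (s : seq (seq R)) :
  all (all (pred1 0)) s -> forall i j, nth 0 (nth [::] s i) j = 0.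
Proof.
move=> /(all_nthP [::]) s0 i j.
have [ltis|] := ltnP i (size s); last by move=> /(nth_default [::]) ->; rewrite nth_nil.
have /(all_nthP 0) r0 := s0 _ ltis.
have [ltj|] := ltnP j (size (nth [::] s i)); last by move=> /(nth_default 0) ->.
exact/eqP/r0.
Qed.

(** The shape ensures that every listed entry occurs in the matrix: entry [j] of row [i] sits at
    [(i, i + j)]. *)
Lemma sym_mx_eq0 n (s : seq (seq R)) : shape s = rev (iota 1 n) ->
  sym_mx n s = 0 <-> all (all (pred1 0)) s.
Proof.
move=> sh; have szs : size s = n by rewrite -(size_map size) -/(shape s) sh size_rev size_iota.
split=> [/matrixP s0|/all_rows_eq0 s0]; last first.
  by apply/matrixP => i j; rewrite !mxE s0.
apply/(all_nthP [::]) => i ltis; apply/(all_nthP 0) => j.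
rewrite -(nth_map [::] 0%N) // -/(shape s) sh nth_rev ?size_iota -?szs //.
have -> : nth 0%N (iota 1 (size s)) (size s - i.+1) = (size s - i)%N.
  by rewrite nth_iota ?add1n ?subnSK ?leq_subr.
move=> ltj.
have ltin : (i < n)%N by rewrite -szs.
have ltijn : (i + j < n)%N by rewrite -szs -ltn_subRL.
have {}s0 := s0 (Ordinal ltin) (Ordinal ltijn).
move: s0; rewrite !mxE /=.
by rewrite (minn_idPl _) ?leq_addr // (maxn_idPr _) ?leq_addr // addKn => /eqP.
Qed.

Lemma rows_mx_eq0 m n (s : seq (seq R)) : shape s = nseq m n ->
  rows_mx m n s = 0 <-> all (all (pred1 0)) s.
Proof.
move=> sh; have szs : size s = m by rewrite -(size_map size) -/(shape s) sh size_nseq.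
split=> [/matrixP s0|/all_rows_eq0 s0]; last first.
  by apply/matrixP => i j; rewrite !mxE s0.
apply/(all_nthP [::]) => i ltis; apply/(all_nthP 0) => j.
rewrite -(nth_map [::] 0%N) // -/(shape s) sh nth_nseq -szs ltis => ltj.
rewrite szs in ltis.
by have := s0 (Ordinal ltis) (Ordinal ltj); rewrite !mxE /= => /eqP.
Qed.

Lemma row_nth_eq0 n (s : seq R) : size s = n ->
  \row_(k < n) nth 0 s k = 0 :> 'rV[R]_n <-> all (pred1 0) s.
Proof.
move=> sz; split=> [/rowP s0|/(all_nthP 0) s0].
  apply/(all_nthP 0) => k; rewrite sz => ltk.
  by have := s0 (Ordinal ltk); rewrite !mxE => /eqP.
by apply/rowP => k; rewrite !mxE; apply/eqP/s0; rewrite sz.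
Qed.

End Dimension.

(** * The moduli as coordinates on elasticity tensors, and the rotations about the third axis *)

Section Coordinates.
Variable R : realType.
Implicit Types (C D : elasticity R) (c s : R).

Lemma forall_I3 (P : 'I_3 -> Prop) : P i1 -> P i2 -> P i3 -> forall i, P i.
Proof.
move=> P1 P2 P3 [[|[|[|//]]] lti].
- by rewrite (_ : Ordinal lti = i1) //; apply: val_inj.
- by rewrite (_ : Ordinal lti = i2) //; apply: val_inj.
- by rewrite (_ : Ordinal lti = i3) //; apply: val_inj.
Qed.

Lemma sum_I3 (g : 'I_3 -> R) : \sum_i g i = g i1 + g i2 + g i3.
Proof.
rewrite 3!big_ord_recl big_ord0 addr0 addrA.
by congr (g _ + g _ + g _); apply: val_inj.
Qed.

Definition voigt_index (i j : 'I_3) : nat :=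
  nth 0 (nth [::] [:: [:: 1; 6; 5]; [:: 6; 2; 4]; [:: 5; 4; 3]] i) j.

Lemma voigt_indexC i j : voigt_index i j = voigt_index j i.
Proof. by elim/forall_I3: i; elim/forall_I3: j. Qed.

Lemma voigt_indexK i j :
  voigt (voigt_index i j) = (i, j) \/ voigt (voigt_index i j) = (j, i).
Proof. by elim/forall_I3: i; elim/forall_I3: j; (left + right). Qed.

Lemma modulusC C I J : modulus C I J = modulus C J I.
Proof.
rewrite /modulus; case: (voigt I) => i j; case: (voigt J) => k l.
by have /elastic_symP/(_ i j k l)[_ ->] := valP C.
Qed.

Lemma tensor_modulus C i j k l :
  (C : tensor4 R) (i, j, k, l) = modulus C (voigt_index i j) (voigt_index k l).
Proof.
have /elastic_symP symC := valP C.
have symCr p q r t : (C : tensor4 R) (p, q, r, t) = (C : tensor4 R) (p, q, t, r).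
  by have [_ ->] := symC p q r t; have [-> _] := symC r t p q;
    have [_ ->] := symC t r p q.
rewrite /modulus; case: (voigt_indexK i j) => ->; case: (voigt_indexK k l) => -> //.
- by have [-> _] := symC i j k l.
- by have [-> _] := symC i j k l; rewrite symCr.
Qed.

(** Ordering the two Voigt indices gives each component a normal form, which is the one used in
    [voigt_pairs]. Equal moduli then become the same atom for [ring]. *)
Lemma tensor_modulus_ordered C i j k l :
  (C : tensor4 R) (i, j, k, l) =
    modulus C (minn (voigt_index i j) (voigt_index k l))
              (maxn (voigt_index i j) (voigt_index k l)).
Proof. by rewrite tensor_modulus; case: ltnP => _ //; rewrite modulusC. Qed.

Definition voigt_pairs : seq (nat * nat) :=
  [:: (1, 1); (2, 2); (3, 3); (2, 3); (1, 3); (1, 2); (4, 4); (5, 5); (6, 6);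
      (1, 4); (2, 5); (3, 6); (3, 4); (1, 5); (2, 6); (2, 4); (3, 5); (1, 6);
      (5, 6); (4, 6); (4, 5)]%N.

Lemma moduliE C (n : 'I_(9 + 12)) :
  moduli C n 0 = let p := nth (0, 0)%N voigt_pairs n in modulus C p.1 p.2.
Proof. by rewrite mxE; case: n; do 21?[case=> //]. Qed.

Definition pair_index (I J : nat) : nat :=
  index (minn I J, maxn I J) voigt_pairs.

Lemma pair_indexC I J : pair_index I J = pair_index J I.
Proof. by rewrite /pair_index minnC maxnC. Qed.

Definition tensor_of_moduli (x : nat -> R) : tensor4 R :=
  [ffun p : 'I_3 * 'I_3 * 'I_3 * 'I_3 => let: (i, j, k, l) := p in
     x (pair_index (voigt_index i j) (voigt_index k l))].

Fact tensor_of_moduli_sym x : tensor_of_moduli x \in elastic_sym.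
Proof.
apply/elastic_symP => i j k l; rewrite !ffunE; split.
  by rewrite voigt_indexC.
by rewrite pair_indexC.
Qed.

Definition of_moduli (x : nat -> R) : elasticity R :=
  Elasticity (tensor_of_moduli_sym x).

Lemma modulus_of_moduli x I J : (0 < I <= 6)%N -> (0 < J <= 6)%N ->
  modulus (of_moduli x) I J = x (pair_index I J).
Proof.
by case: I => // -[|[|[|[|[|[|//]]]]]] _; case: J => // -[|[|[|[|[|[|//]]]]]] _;
   rewrite /modulus /= ffunE.
Qed.

Lemma elasticity_eq C D :
  (forall p, p \in voigt_pairs -> modulus C p.1 p.2 = modulus D p.1 p.2) -> C = D.
Proof.
move=> CD; apply/val_inj/ffunP => -[[[i j] k] l] /=.
rewrite !tensor_modulus_ordered; apply: (CD (_, _)).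
by elim/forall_I3: i; elim/forall_I3: j; elim/forall_I3: k; elim/forall_I3: l.
Qed.

Lemma modulus_lin a C D I J :
  modulus (a *: C + D) I J = a * modulus C I J + modulus D I J.
Proof.
rewrite /modulus; case: (voigt I) => i j; case: (voigt J) => k l.
by rewrite /= !ffunE.
Qed.

Definition rotation c s : 'M[R]_3 :=
  rows_mx 3 3 [:: [:: c; - s; 0]; [:: s; c; 0]; [:: 0; 0; 1]].

Lemma SO2P (Q : 'M[R]_3) :
  SO2 Q <-> exists c s, c ^+ 2 + s ^+ 2 = 1 /\ Q = rotation c s.
Proof.
have detQ (M : 'M[R]_3) : M i1 i3 = 0 -> M i2 i3 = 0 -> M i3 i3 = 1 ->
    \det M = M i1 i1 * M i2 i2 - M i1 i2 * M i2 i1.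
  move=> M13 M23 M33; rewrite (expand_det_col _ i3) sum_I3 M13 M23 M33.
  rewrite !mul0r !add0r mul1r /cofactor (expand_det_row _ 0).
  rewrite !big_ord_recl big_ord0 /cofactor !det_mx11 !mxE.
  transitivity ((-1) ^+ 4 * (M i1 i1 * ((-1) ^+ 0 * M i2 i2)
      + (M i1 i2 * ((-1) ^+ 1 * M i2 i1) + 0))); last by ring.
  by congr (_ * (M _ _ * (_ * M _ _) + (M _ _ * (_ * M _ _) + _)));
    apply: val_inj.
split=> [[/matrixP QQ dQ /matrixP Qe]|[c [s [cs ->]]]].
  have Qi3 i : Q i i3 = (i == i3)%:R.
    by have := Qe i 0; rewrite !mxE sum_I3 !mxE /= !mulr0 !add0r mulr1 andbT.
  have := QQ i3 i3; have := QQ i1 i1; have := QQ i2 i2; move: dQ.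
  rewrite detQ ?Qi3 // !mxE !sum_I3 !mxE !Qi3 /= !mulr0 !addr0 mulr1.
  move=> d q2 q1 q3.
  have sumsq0 (x y : R) : x ^+ 2 + y ^+ 2 = 0 -> x = 0 /\ y = 0.
    move/eqP; rewrite paddr_eq0 ?sqr_ge0 // !sqrf_eq0.
    by case/andP => /eqP -> /eqP ->.
  have [Q31 Q32] : Q i3 i1 = 0 /\ Q i3 i2 = 0 by apply: sumsq0; lra.
  (* The sum of the squares of these two numbers is the sum of the squared norms of the first two
     rows minus twice the determinant, that is [1 + 1 - 2 = 0]. *)
  have [] : Q i1 i1 - Q i2 i2 = 0 /\ Q i1 i2 + Q i2 i1 = 0.
    by apply: sumsq0; lra.
  move=> /subr0_eq Q22 /eqP; rewrite addr_eq0 => /eqP Q12.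
  exists (Q i1 i1), (Q i2 i1); split.
    by rewrite Q12 in q1; lra.
  apply/matrixP; do 2![elim/forall_I3]; rewrite !mxE /= ?Qi3 //.
split.
- apply/matrixP; do 2![elim/forall_I3]; rewrite !mxE sum_I3 !mxE /=; lra.
- rewrite detQ; rewrite !mxE //=; lra.
- apply/matrixP; elim/forall_I3 => j; rewrite !mxE sum_I3 !mxE ord1 /=; lra.
Qed.

End Coordinates.

(** * Complex coordinates that diagonalise the rotations *)

Section Weights.
Variable R : realType.
Implicit Types (C D : elasticity R) (c s : R) (x y : nat -> R).

Definition weight (j : nat) : nat :=
  nth 0 [:: 0; 0; 0; 0; 0; 1; 1; 1; 2; 2; 2; 3; 4] j.

(** Put [P = e1^2 + e2^2], [Z = e3^2], [a = e3 (e1 + i e2)] and [b = (e1 + i e2)^2]. The coordinates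
    are, in order, the values of [C] on the pairs [PP], [PZ], [ZZ], [a conj a], [b conj b], [Pa],
    [Za], [conj a b], [Pb], [Zb], [aa], [ab], [bb]. Beyond index 12 the coordinates and the weight
    default to 0, which keeps [act_weight] true for every [j]. *)
Definition wre C (j : nat) : R :=
  let c I J := modulus C I%N J%N in nth 0
  [:: c 1 1 + 2 * c 1 2 + c 2 2; c 1 3 + c 2 3; c 3 3; c 4 4 + c 5 5;
      c 1 1 - 2 * c 1 2 + c 2 2 + 4 * c 6 6;
      c 1 5 + c 2 5; c 3 5; c 1 5 - c 2 5 + 2 * c 4 6;
      c 1 1 - c 2 2; c 1 3 - c 2 3; c 5 5 - c 4 4;
      c 1 5 - c 2 5 - 2 * c 4 6;
      c 1 1 - 2 * c 1 2 + c 2 2 - 4 * c 6 6] j.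

Definition wim C (j : nat) : R :=
  let c I J := modulus C I%N J%N in nth 0
  [:: 0; 0; 0; 0; 0;
      c 1 4 + c 2 4; c 3 4; 2 * c 5 6 - c 1 4 + c 2 4;
      2 * c 1 6 + 2 * c 2 6; 2 * c 3 6; 2 * c 4 5;
      2 * c 5 6 + c 1 4 - c 2 4;
      4 * c 1 6 - 4 * c 2 6] j.

(** The real and imaginary parts of [(c + i s)^k]. *)
Fixpoint rotpow c s (k : nat) : R * R :=
  if k is k'.+1 then
    let z := rotpow c s k' in (c * z.1 - s * z.2, s * z.1 + c * z.2)
  else (1, 0).

Lemma rotpow_unit c s k : c ^+ 2 + s ^+ 2 = 1 ->
  (rotpow c s k).1 ^+ 2 + (rotpow c s k).2 ^+ 2 = 1.
Proof.
move=> cs; elim: k => [|k IH] /=; first by ring.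
by rewrite -[RHS]mulr1 -{1}cs -IH; ring.
Qed.

Lemma sum_rot c s (g : 'I_3 -> R) :
  [/\ \sum_p rotation c s i1 p * g p = c * g i1 - s * g i2,
      \sum_p rotation c s i2 p * g p = s * g i1 + c * g i2 &
      \sum_p rotation c s i3 p * g p = g i3].
Proof. by split; rewrite sum_I3 !mxE /=; ring. Qed.

Lemma act_tensorE (Q : 'M[R]_3) (C : tensor4 R) i j k l :
  act_tensor Q C (i, j, k, l) =
    \sum_p Q i p * \sum_q Q j q * \sum_r Q k r * \sum_t Q l t * C (p, q, r, t).
Proof.
rewrite ffunE; apply: eq_bigr => p _; rewrite mulr_sumr; apply: eq_bigr => q _.
rewrite mulr_sumr mulr_sumr; apply: eq_bigr => r _.
rewrite !mulr_sumr; apply: eq_bigr => t _.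
by rewrite !mulrA.
Qed.

Lemma act_weight c s C j :
    c ^+ 2 + s ^+ 2 = 1 ->
  let z := rotpow c s (weight j) in
  wre (act (rotation c s) C) j = z.1 * wre C j - z.2 * wim C j /\
  wim (act (rotation c s) C) j = z.2 * wre C j + z.1 * wim C j.
Proof.
move=> cs z.
suff [e [-> ->]] : exists e : nat,
    wre (act (rotation c s) C) j
      = (c ^+ 2 + s ^+ 2) ^+ e * (z.1 * wre C j - z.2 * wim C j) /\
    wim (act (rotation c s) C) j
      = (c ^+ 2 + s ^+ 2) ^+ e * (z.2 * wre C j + z.1 * wim C j).
  by rewrite cs expr1n !mul1r.
(* Homogenized in this way, the claims hold for all c and s. *)
move: @z; rewrite /wre /wim.
(* A component with [d] indices different from 3 transforms with degree [d] in [c] and [s], while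
   [z] has degree [weight j]. The exponent is half the difference. *)
exists (nth 0 [:: 2; 1; 0; 1; 2; 1; 0; 1; 1; 0; 0; 0; 0] j)%N.
have sumr1 g := let: And3 h _ _ := sum_rot c s g in h.
have sumr2 g := let: And3 _ h _ := sum_rot c s g in h.
have sumr3 g := let: And3 _ _ h := sum_rot c s g in h.
have actE I J : modulus (act (rotation c s) C) I J =
  let: (i, j) := voigt I in let: (k, l) := voigt J in
    \sum_p rotation c s i p * \sum_q rotation c s j q * \sum_r rotation c s k r *
      \sum_t rotation c s l t *
      modulus C (minn (voigt_index p q) (voigt_index r t))
              (maxn (voigt_index p q) (voigt_index r t)).
  rewrite /modulus /=; case: (voigt I) => i j'; case: (voigt J) => k l.
  rewrite act_tensorE; do 4![apply: eq_bigr => ? _; congr (_ * _)].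
  exact: tensor_modulus_ordered.
do 13?[case: j => [|j]];
  rewrite /= ?actE /= ?(sumr1, sumr2, sumr3) /voigt_index /= ?nth_nil;
  split; ring.
Qed.

(* y 0, ..., y 4 are ignored. *)
Definition of_weights x y : elasticity R :=
  let x j := x j%N in let y j := y j%N in of_moduli (fun n => nth 0
  [:: (x 0 + (x 4 + x 12) / 2) / 4 + x 8 / 2;
      (x 0 + (x 4 + x 12) / 2) / 4 - x 8 / 2; x 2;
      (x 1 - x 9) / 2; (x 1 + x 9) / 2; (x 0 - (x 4 + x 12) / 2) / 4;
      (x 3 - x 10) / 2; (x 3 + x 10) / 2; (x 4 - x 12) / 8;
      (y 5 + (y 11 - y 7) / 2) / 2; (x 5 - (x 7 + x 11) / 2) / 2; y 9 / 2; y 6;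
      (x 5 + (x 7 + x 11) / 2) / 2; y 8 / 4 - y 12 / 8;
      (y 5 - (y 11 - y 7) / 2) / 2; x 6; y 8 / 4 + y 12 / 8;
      (y 7 + y 11) / 4; (x 7 - x 11) / 4; y 10 / 2] n).

Lemma of_weightsK C : of_weights (wre C) (wim C) = C.
Proof.
apply: elasticity_eq => p.
rewrite /voigt_pairs !inE; do 21?[case/predU1P => [->|]]; try (move/eqP => ->);
  rewrite modulus_of_moduli //= /wre /wim /=; by field.
Qed.

Lemma wre_of_weights x y j : (j < 13)%N -> wre (of_weights x y) j = x j.
Proof.
by do 13?[case: j => [|j]] => // _;
  rewrite /wre /= !modulus_of_moduli //=; by field.
Qed.

Lemma wim_of_weights x y j :
  wim (of_weights x y) j = if (4 < j < 13)%N then y j else 0.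
Proof.
by do 13?[case: j => [|j]] => //=;
  rewrite /wim /= ?modulus_of_moduli //= ?nth_nil //; by field.
Qed.

Lemma of_weights_lin a x y x' y' :
  of_weights (fun j => a * x j + x' j) (fun j => a * y j + y' j)
  = a *: of_weights x y + of_weights x' y'.
Proof.
apply: elasticity_eq => p.
rewrite /voigt_pairs !inE; do 21?[case/predU1P => [->|]]; try (move/eqP => ->);
  rewrite modulus_lin !modulus_of_moduli //=; by field.
Qed.

Lemma act_lin (Q : 'M[R]_3) a C D :
  act Q (a *: C + D) = a *: act Q C + act Q D.
Proof.
apply/val_inj/ffunP => -[[[i j] k] l] /=.
transitivity (a * act_tensor Q C (i, j, k, l) + act_tensor Q D (i, j, k, l));
  last by rewrite !ffunE.
rewrite !act_tensorE.
do 4![rewrite mulr_sumr -big_split; apply: eq_bigr => ? _ /=; rewrite mulrCA -mulrDr; congr (_ * _)].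
by rewrite !ffunE.
Qed.

End Weights.

(** * Invariant forms only pair coordinates of equal weight *)

Section Invariants.
Variable R : realType.
Implicit Types (C D : elasticity R) (c s : R) (x y : nat -> R).

(** [g] is the coefficient of [Re (conj w_j w_l)] and [h] that of [Im (conj w_j w_l)]. Both orders
    of a pair are summed, so only the symmetric part of [g] and the antisymmetric part of [h]
    count. *)
Definition weight_form (g h : nat -> nat -> R) C : R :=
  \sum_(j < 13) \sum_(l < 13 | weight j == weight l)
    (g j l * (wre C j * wre C l + wim C j * wim C l)
     + h j l * (wre C j * wim C l - wim C j * wre C l)).

Lemma weight_form_act c s g h C : c ^+ 2 + s ^+ 2 = 1 ->
  weight_form g h (act (rotation c s) C) = weight_form g h C.
Proof.
move=> cs; apply: eq_bigr => j _; apply: eq_bigr => l /eqP jl.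
have [-> ->] := act_weight C j cs; have [-> ->] := act_weight C l cs.
rewrite -jl; have := rotpow_unit (weight j) cs; case: rotpow => a b /= ab.
(* Multiplying the original products by [a ^+ 2 + b ^+ 2 = 1] makes both sides homogeneous in [a]
   and [b]. *)
rewrite -[X in _ = g j l * X + _]mul1r -[X in _ = _ + h j l * X]mul1r -ab.
by ring.
Qed.

Lemma of_weights_ext x y x' y' :
  (forall j, (j < 13)%N -> x j = x' j) ->
  (forall j, (4 < j < 13)%N -> y j = y' j) ->
  of_weights x y = of_weights x' y'.
Proof. by move=> xx yy; rewrite /of_weights !xx ?yy. Qed.

Lemma act_of_weights c s x y : c ^+ 2 + s ^+ 2 = 1 ->
  act (rotation c s) (of_weights x y) =
    let z j := rotpow c s (weight j) in
    of_weights (fun j => (z j).1 * x j - (z j).2 * y j)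
               (fun j => (z j).2 * x j + (z j).1 * y j).
Proof.
move=> cs /=; rewrite -[LHS]of_weightsK; apply: of_weights_ext => j ltj;
  have [re_act im_act] := act_weight (of_weights x y) j cs.
  rewrite re_act wim_of_weights wre_of_weights // ltj andbT; case: ltnP => // j4.
  have -> : weight j = 0%N by move: j4; clear; do 5?[case: j => [|j] //].
  by rewrite /= !mul0r.
by rewrite im_act wim_of_weights ltj wre_of_weights //; case/andP: ltj.
Qed.

(** [wX] and [wY] are dual to the coordinates [wre] and [wim]. For [j < 5] the coordinate is real
    and [wY j] is 0. *)
Definition wX (j : nat) : elasticity R :=
  of_weights (fun l => (l == j)%:R) (fun=> 0).
Definition wY (j : nat) : elasticity R :=
  of_weights (fun=> 0) (fun l => (l == j)%:R).

Lemma of_weights0 : of_weights (fun=> 0) (fun=> 0) = 0 :> elasticity R.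
Proof.
have /= := @of_weights_lin R (-1) (fun=> 0) (fun=> 0) (fun=> 0) (fun=> 0).
rewrite scaleN1r addNr => <-.
by apply: of_weights_ext => j _; rewrite mulr0 addr0.
Qed.

Lemma of_weightsZXY a b j :
  a *: wX j + b *: wY j
  = of_weights (fun l => a * (l == j)%:R) (fun l => b * (l == j)%:R).
Proof.
rewrite -[b *: _]addr0 -of_weights0 -!of_weights_lin.
by apply: of_weights_ext => l _; ring.
Qed.

Lemma weights_sum C : C = \sum_(0 <= j < 13) (wre C j *: wX j + wim C j *: wY j).
Proof.
have sumE (r : seq nat) : \sum_(j <- r) (wre C j *: wX j + wim C j *: wY j) =
    of_weights (fun l => \sum_(j <- r) wre C j * (l == j)%:R)
               (fun l => \sum_(j <- r) wim C j * (l == j)%:R).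
  elim: r => [|j r IH].
    by rewrite big_nil -of_weights0; congr of_weights; apply: funext => l; rewrite big_nil.
  rewrite big_cons IH of_weightsZXY -[X in X + _]scale1r -of_weights_lin.
  by congr of_weights; apply: funext => l; rewrite big_cons mul1r.
have sum_delta (f : nat -> R) l : (l < 13)%N ->
    \sum_(0 <= j < 13) f j * (l == j)%:R = f l.
  move=> ltl; rewrite (bigD1_seq l) ?iota_uniq ?mem_index_iota //= eqxx mulr1.
  by rewrite big1 ?addr0 // => j; rewrite eq_sym => /negPf ->; rewrite mulr0.
rewrite sumE -[LHS]of_weightsK; apply: of_weights_ext => l ltl; rewrite sum_delta //.
by case/andP: ltl.
Qed.

Lemma act_wXY c s j : c ^+ 2 + s ^+ 2 = 1 ->
  let z := rotpow c s (weight j) in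
  act (rotation c s) (wX j) = z.1 *: wX j + z.2 *: wY j /\
  act (rotation c s) (wY j) = (- z.2) *: wX j + z.1 *: wY j.
Proof.
move=> cs z; rewrite !of_weightsZXY !act_of_weights //=; split;
  apply: of_weights_ext => l _; rewrite /z; case: eqP => [->|_]; rewrite /=; ring.
Qed.

Lemma wim_weight0 C j : weight j = 0%N -> wim C j = 0.
Proof. by do 13?[case: j => [|j] //=]; rewrite /wim /= nth_nil. Qed.

(* The hypotheses say that a bilinear form is fixed by the rotation by
   z = C + iS in its first argument and by z' = C' + iS' in the second one; this
   multiplies (alpha + delta) - i (beta - gamma) by conj z * z'. *)
Lemma rotation_fixed (C S C' S' : R) (alpha beta gamma delta : R) :
  C ^+ 2 + S ^+ 2 = 1 -> C' ^+ 2 + S' ^+ 2 = 1 -> C * C' + S * S' != 1 ->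
  alpha = C * C' * alpha + C * S' * beta + S * C' * gamma + S * S' * delta ->
  beta = - (C * S') * alpha + C * C' * beta - S * S' * gamma + S * C' * delta ->
  gamma = - (S * C') * alpha - S * S' * beta + C * C' * gamma + C * S' * delta ->
  delta = S * S' * alpha - S * C' * beta - C * S' * gamma + C * C' * delta ->
  alpha + delta = 0 /\ beta - gamma = 0.
Proof.
move=> u u' ne1 ea eb eg ed.
have ne : (2 - 2 * (C * C' + S * S')) != 0.
  by apply: contra ne1 => /eqP e; apply/eqP; lra.
(* [k] and [m] are the real and imaginary parts of [conj z * z']. The equations become a linear
   system in [p] and [q] with determinant [(1 - k)^2 + m^2 = 2 - 2 k], which is nonzero. *)
set k := C * C' + S * S' in ne *.
set m := C * S' - S * C'.
have km : (1 - k) ^+ 2 + m ^+ 2 = 2 - 2 * k.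
  have e1 : k ^+ 2 + m ^+ 2 = 1 by rewrite -[RHS]mulr1 -{1}u -u' /k /m; ring.
  lra.
set p := alpha + delta; set q := beta - gamma.
have ep : (1 - k) * p = m * q.
  rewrite /p /q /k /m; lra.
have eq : (1 - k) * q = - m * p by rewrite /p /q /k /m; lra.
split; apply: (mulfI ne); rewrite mulr0 -km mulrDl.
  by rewrite expr2 -mulrA ep mulrCA eq; ring.
by rewrite expr2 -mulrA eq mulrCA ep; ring.
Qed.


(** [B] is the symmetrised bilinear form. Polarisation recovers it from [phi], and [act Q] is
    linear, so [B] inherits every invariance of [phi]. *)
Lemma quadratic_form_polar (phi : elasticity R -> R^o) : quadratic_form phi ->
  exists B : elasticity R -> elasticity R -> R,
    [/\ forall C D, B C D = B D C,
        forall a C C' D, B (a *: C + C') D = a * B C D + B C' D,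
        forall C, phi C = B C C &
        forall Q, (forall C, phi (act Q C) = phi C) ->
          forall C D, B (act Q C) (act Q D) = B C D].
Proof.
case=> b phib; exists (fun C D => (b C D + b D C) / 2).
have bl a C C' D : b (a *: C + C') D = a * b C D + b C' D by rewrite linearPl.
have br a C C' D : b D (a *: C + C') = a * b D C + b D C' by rewrite linearPr.
split=> [C D|a C C' D|C|Q phiQ C D].
- by rewrite addrC.
- by rewrite bl br; field.
- by rewrite phib; field.
congr (_ / 2).
have polar E F : b E F + b F E = phi (1 *: E + F) - phi E - phi F.
  by rewrite !phib bl !br; ring.
by rewrite !polar -act_lin !phiQ.
Qed.

(** For [u = (3 + 4 i) / 5] the two expressions are the real parts of [u^(k - l)] and [u^(k + l)].
    Only finitely many powers occur, and each is checked by computation. *)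
Lemma rotpow_dot_neq1 k l : (k <= 4)%N -> (l <= 4)%N ->
  let z := rotpow (3 / 5) (4 / 5 : R) k in let w := rotpow (3 / 5) (4 / 5) l in
  (k != l -> z.1 * w.1 + z.2 * w.2 != 1) /\
  ((k, l) != (0, 0)%N -> z.1 * w.1 - z.2 * w.2 != 1).
Proof.
by do 5?[case: k => [|k] //]; do 5?[case: l => [|l] //] => _ _;
  split=> // _; apply/eqP => /= h; lra.
Qed.

Lemma weight_le4 j : (weight j <= 4)%N.
Proof. by do 13?[case: j => [|j] //]; rewrite /weight /= nth_nil. Qed.

Lemma invariant_weight_form (phi : elasticity R -> R^o) :
  quadratic_form phi -> invariant_under (@SO2 R) phi ->
  exists g h, forall C, phi C = weight_form g h C.
Proof.
move=> /quadratic_form_polar[B [BC Bl phiB BQ]] phi_inv.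
have Br a C C' D : B D (a *: C + C') = a * B D C + B D C'.
  by rewrite BC Bl !(BC D).
have B0 D : B 0 D = 0.
  by have := Bl (-1) 0 0 D; rewrite scaler0 addr0; lra.
have B0' D : B D 0 = 0 by rewrite BC.
have BZ a C D : B (a *: C) D = a * B C D.
  by have := Bl a C 0 D; rewrite addr0 B0 addr0.
have BZ' a C D : B D (a *: C) = a * B D C by rewrite BC BZ BC.
(* The rotation of angle arccos (3/5) already separates the weights. *)
have cs : (3 / 5) ^+ 2 + (4 / 5) ^+ 2 = 1 :> R by field.
have {}BQ := BQ (rotation (3 / 5) (4 / 5)) (fun C => phi_inv _ C _).
have {}BQ C D : B (act (rotation (3 / 5) (4 / 5)) C) (act (rotation (3 / 5) (4 / 5)) D) = B C D.
  by apply: BQ; apply/SO2P; do 2 eexists; split; [exact: cs|].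
(* The first pair of equations kills the part of [B] that rotates with the difference of the two
   weights, the second the part that rotates with their sum. The sum is 0 only when both weights
   are. *)
have separate j l :
    (weight j != weight l -> B (wX j) (wX l) + B (wY j) (wY l) = 0 /\
                             B (wX j) (wY l) - B (wY j) (wX l) = 0) /\
    ((weight j, weight l) != (0, 0)%N ->
      B (wX j) (wX l) - B (wY j) (wY l) = 0 /\
      B (wX j) (wY l) + B (wY j) (wX l) = 0).
  have [eXj eYj] := act_wXY j cs; have [eXl eYl] := act_wXY l cs.
  have := BQ (wX j) (wX l); have := BQ (wX j) (wY l).
  have := BQ (wY j) (wX l); have := BQ (wY j) (wY l).
  rewrite {BQ} eXj eYj eXl eYl !Bl !Br !BZ !BZ'.
  have [ne1 ne2] := rotpow_dot_neq1 (weight_le4 j) (weight_le4 l).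
  have u := rotpow_unit (weight j) cs; have v := rotpow_unit (weight l) cs.
  move: ne1 ne2 u v; case: rotpow => a b; case: rotpow => a' b' /=.
  move=> ne1 ne2 u v e1 e2 e3 e4; split=> ne.
    by apply: (rotation_fixed u v (ne1 ne)); lra.
  rewrite -[X in _ = 0 /\ X]/(B (wX j) (wY l) + B (wY j) (wX l) = 0).
  (* Changing the signs of [b'] and of [wY l] conjugates the second coordinate, which turns the sum
     of the weights into a difference. *)
  have [||||||p q] := @rotation_fixed a b a' (- b') (B (wX j) (wX l))
    (- B (wX j) (wY l)) (B (wY j) (wX l)) (- B (wY j) (wY l)) u.
  - by rewrite sqrrN.
  - by rewrite mulrN ne2.
  - lra.
  - lra.
  - lra.
  - lra.
  by split; lra.
(* These two values suffice. For equal nonzero weights the other two are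
   [B (wY j) (wY l) = B (wX j) (wX l)] and [B (wY j) (wX l) = - B (wX j) (wY l)]; in weight 0 the
   imaginary parts vanish; for distinct weights all four values are 0. *)
exists (fun j l => B (wX j) (wX l)), (fun j l => B (wX j) (wY l)) => C.
rewrite phiB.
have Bsum (r : seq nat) (f : nat -> elasticity R) D :
    B (\sum_(j <- r) f j) D = \sum_(j <- r) B (f j) D.
  elim: r => [|j r IH]; first by rewrite !big_nil B0.
  by rewrite !big_cons -IH -[f j in LHS]scale1r Bl mul1r.
rewrite {1}(weights_sum C) Bsum big_mkord; apply: eq_bigr => j _.
rewrite BC {1}(weights_sum C) Bsum big_mkord [RHS]big_mkcond /=.
apply: eq_bigr => l _; rewrite BC Bl Br BZ Br !BZ'.
have [sep1 sep2] := separate j l.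
case: eqP => [jl|/eqP jl].
  have [j0|j0] := eqVneq (weight j) 0%N.
    by rewrite !wim_weight0 -?jl // ; ring.
  have [|e1 e2] := sep2; first by apply: contra j0 => /eqP[-> _].
  rewrite (_ : B (wY j) (wX l) = - B (wX j) (wY l)); last lra.
  by rewrite (_ : B (wY j) (wY l) = B (wX j) (wX l)); [ring|lra].
have [e1 e2] := sep1 jl; have [|e3 e4] := sep2.
  by apply: contra jl => /eqP[-> ->].
rewrite (_ : B (wX j) (wX l) = 0); last lra.
rewrite (_ : B (wX j) (wY l) = 0); last lra.
rewrite (_ : B (wY j) (wX l) = 0); last lra.
by rewrite (_ : B (wY j) (wY l) = 0); [ring|lra].
Qed.

End Invariants.

(** * Translation between the displayed matrices and the weight coordinates *)

Section Matrices.
Variable R : realType.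
Implicit Types (C D : elasticity R) (f b d g h : nat -> nat -> R).

Definition quad (F : 'M[R]_(9 + 12)) C : R := ((moduli C)^T *m F *m moduli C) 0 0.

(** Sums over ranges of naturals compute once [unlock]ed, which leaves explicit polynomial
    identities for [field]. *)
Definition sym_sum n (s : seq (seq R)) (x : nat -> R) : R :=
  \sum_(0 <= i < n) \sum_(0 <= j < n)
     nth 0 (nth [::] s (minn i j)) (maxn i j - minn i j) * (x i * x j).

Definition rows_sum m n (s : seq (seq R)) (x y : nat -> R) : R :=
  \sum_(0 <= i < m) \sum_(0 <= j < n) nth 0 (nth [::] s i) j * (x i * y j).

Lemma bilinear_mxE m n (F : 'M[R]_(m, n)) (x : 'cV_m) (y : 'cV_n) :
  (x^T *m F *m y) 0 0 = \sum_i \sum_j F i j * (x i 0 * y j 0).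
Proof.
rewrite -mulmxA mxE; apply: eq_bigr => i _; rewrite !mxE mulr_sumr.
by apply: eq_bigr => j _; rewrite mulrCA.
Qed.

Lemma quad_sym_mx n s (x : nat -> R) :
  ((\col_(i < n) x i)^T *m sym_mx n s *m \col_(i < n) x i) 0 0 = sym_sum n s x.
Proof.
rewrite bilinear_mxE /sym_sum big_mkord; apply: eq_bigr => i _.
by rewrite big_mkord; apply: eq_bigr => j _; rewrite !mxE.
Qed.

Lemma quad_rows_mx m n s (x y : nat -> R) :
  ((\col_(i < m) x i)^T *m rows_mx m n s *m \col_(i < n) y i) 0 0
  = rows_sum m n s x y.
Proof.
rewrite bilinear_mxE /rows_sum big_mkord; apply: eq_bigr => i _.
by rewrite big_mkord; apply: eq_bigr => j _; rewrite !mxE.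
Qed.

Definition modulus_seq C (n : nat) : R :=
  let p := nth (0, 0)%N voigt_pairs n in modulus C p.1 p.2.

Lemma moduli_col_mx C :
  moduli C = col_mx (\col_(i < 9) modulus_seq C i)
                    (\col_(i < 12) modulus_seq C (9 + i)).
Proof.
apply/colP => k; rewrite moduliE -(splitK k).
by case: (fintype.split k) => i; rewrite ?col_mxEu ?col_mxEd mxE.
Qed.

Lemma quad_F1 s t C :
  quad (block_mx (sym_mx 9 s) 0 0 (sym_mx 12 t)) C
  = sym_sum 9 s (modulus_seq C) + sym_sum 12 t (fun i => modulus_seq C (9 + i)).
Proof.
rewrite /quad moduli_col_mx tr_col_mx mul_row_block mul_row_col.
rewrite !mulmx0 addr0 add0r mxE (quad_sym_mx 9 s (modulus_seq C)).
by rewrite (quad_sym_mx 12 t (fun i => modulus_seq C (9 + i))).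
Qed.

Lemma quad_F2 s t C :
  quad (block_mx 0 (rows_mx 9 12 s) (rows_mx 9 12 s)^T (sym_mx 12 t)) C
  = 2 * rows_sum 9 12 s (modulus_seq C) (fun i => modulus_seq C (9 + i))
    + sym_sum 12 t (fun i => modulus_seq C (9 + i)).
Proof.
set x := modulus_seq C; set y := fun i => modulus_seq C (9 + i).
rewrite /quad moduli_col_mx tr_col_mx mul_row_block mul_row_col.
rewrite !mulmx0 add0r mulmxDl mxE [X in _ + X]mxE addrA.
rewrite (quad_sym_mx 12 t y) (quad_rows_mx 9 12 s x y).
rewrite mulr_natl mulr2n; congr (_ + _ + _).
rewrite bilinear_mxE exchange_big /rows_sum big_mkord; apply: eq_bigr => i _.
by rewrite big_mkord; apply: eq_bigr => j _; rewrite !mxE [X in _ * X]mulrC.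
Qed.

Lemma weight_formE g h C : weight_form g h C =
  \sum_(0 <= j < 13) \sum_(0 <= l < 13)
    if weight j == weight l then
      g j l * (wre C j * wre C l + wim C j * wim C l)
       + h j l * (wre C j * wim C l - wim C j * wre C l)
    else 0.
Proof.
rewrite /weight_form big_mkord; apply: eq_bigr => j _.
by rewrite big_mkord big_mkcond.
Qed.

(** The table inverts the substitution made in [F1_weight_form]. Here [u], [v] and [p] are the
    coefficients of [|w_12|^2], [|w_4|^2] and [Re (w_5 conj w_7)], while [r] and [q] are the sum and
    the difference of those of [|w_7|^2] and [|w_11|^2]. Each mixed pair is listed once, above the
    diagonal. *)
Lemma weight_form_F1 f b C : conditions f b = 0 ->
  let f i j := f i%N j%N in let b i j := b i%N j%N in
  let u := (b 6 6 - b 6 9) / 32 in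
  let v := f 9 9 / 16 - u in
  let p := (b 5 5 - b 1 1) / 2 in
  let q := (b 5 11 - p) / 2 in
  let r := b 10 10 / 4 in
  let o : R := 0 in
  let g j l := nth 0 (nth [::] 
    [:: [:: f 1 6 / 2 + v + u; f 4 6 + f 4 9 / 2; f 3 6 + f 3 9 / 2;
            f 6 7 + f 7 9 / 2; f 6 9 / 4 + 2 * (v - u)];
        [:: o; (f 4 4 + f 4 5) / 2; 2 * f 3 4; f 4 7 + f 4 8; f 4 9 / 2];
        [:: o; o; f 3 3; 2 * f 3 7; f 3 9 / 2];
        [:: o; o; o; (f 7 7 + f 7 8) / 2; f 7 9 / 2];
        [:: o; o; o; o; v];
        [:: o; o; o; o; o; b 1 7 + r; 2 * b 4 7 - b 4 10; p];
        [:: o; o; o; o; o; o; b 4 4; b 4 10];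
        [:: o; o; o; o; o; o; o; (r + q) / 2];
        [:: o; o; o; o; o; o; o; o; (b 6 6 + b 6 9) / 8; b 3 6 / 2; b 6 12 / 2];
        [:: o; o; o; o; o; o; o; o; o; b 3 3 / 4; b 3 12 / 2];
        [:: o; o; o; o; o; o; o; o; o; o; b 12 12 / 4];
        [:: o; o; o; o; o; o; o; o; o; o; o; (r - q) / 2];
        [:: o; o; o; o; o; o; o; o; o; o; o; o; u]] j) l in
  quad (block_mx (A_mx f) 0 0 (B1_mx b)) C = weight_form g (fun _ _ => 0) C.
Proof.
move=> /row_nth_eq0 -/(_ erefl) /=.
rewrite quad_F1 weight_formE /sym_sum unlock /wre /wim /modulus_seq /=.
(* The last entry of each condition occurs in no other condition. Solving for it eliminates it from
   the goal. *)
do 15![case/andP => + rest;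
  first [rewrite subr_eq0 | rewrite addr_eq0 -eqr_oppLR] => /eqP <-; move: rest].
by move=> _; field.
Qed.

(** The witnesses come from expanding the weight form in the moduli: a diagonal entry is the
    coefficient of a square, an off-diagonal one half the coefficient of a product. *)
Lemma F1_weight_form g : exists f b, conditions f b = 0 /\
  forall C, quad (block_mx (A_mx f) 0 0 (B1_mx b)) C
            = weight_form g (fun _ _ => 0) C.
Proof.
(* [g'] collects the two orders of a pair into one coefficient. *)
pose g' (j l : nat) : R := if j == l then g j l else g j l + g l j.
pose o : R := 0.
pose f i j := nth 0 (nth [::]
  [:: [:: g' 0 0 + g' 0 4 + g' 4 4 + g' 8 8 + g' 12 12;
          g' 0 0 + g' 0 4 + g' 4 4 - g' 8 8 + g' 12 12;
          (g' 0 2 + g' 2 4) / 2;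
          (g' 0 1 + g' 1 4 - g' 8 9) / 2;
          (g' 0 1 + g' 1 4 + g' 8 9) / 2;
          2 * (g' 0 0 - g' 4 4 - g' 12 12);
          (g' 0 3 + g' 3 4 - g' 8 10) / 2;
          (g' 0 3 + g' 3 4 + g' 8 10) / 2;
          2 * g' 0 4 + 4 * g' 4 4 - 4 * g' 12 12];
      [::];
      [:: o; o; g' 2 2; g' 1 2 / 2; o; g' 0 2 - g' 2 4; g' 2 3 / 2; o; 2 * g' 2 4];
      [:: o; o; o; g' 1 1 + g' 9 9; g' 1 1 - g' 9 9; g' 0 1 - g' 1 4;
          (g' 1 3 + g' 9 10) / 2; (g' 1 3 - g' 9 10) / 2; 2 * g' 1 4];
      [::];
      [:: o; o; o; o; o; 4 * (g' 0 0 - g' 0 4 + g' 4 4 + g' 12 12);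
          g' 0 3 - g' 3 4; o; 4 * g' 0 4 - 8 * g' 4 4 + 8 * g' 12 12];
      [:: o; o; o; o; o; o; g' 3 3 + g' 10 10; g' 3 3 - g' 10 10; 2 * g' 3 4];
      [::];
      [:: o; o; o; o; o; o; o; o; 16 * (g' 4 4 + g' 12 12)]] i.-1) j.-1.
pose b i j := nth 0 (nth [::]
  [:: [:: g' 5 5 - g' 5 7 + g' 7 7 + g' 11 11; o; o; (g' 5 6 - g' 6 7) / 2;
          o; o; g' 5 5 - g' 7 7 - g' 11 11; o; o;
          g' 5 7 - 2 * g' 7 7 + 2 * g' 11 11];
      [::];
      [:: o; o; 4 * g' 9 9; o; o; 2 * g' 8 9; o; o; o; o; o; 2 * g' 9 10];
      [:: o; o; o; g' 6 6; o; o; (g' 5 6 + g' 6 7) / 2; o; o; g' 6 7];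
      [:: o; o; o; o; g' 5 5 + g' 5 7 + g' 7 7 + g' 11 11; o; o; o; o; o;
          g' 5 7 + 2 * g' 7 7 - 2 * g' 11 11];
      [:: o; o; o; o; o; 4 * g' 8 8 + 16 * g' 12 12; o; o;
          4 * g' 8 8 - 16 * g' 12 12; o; o; 2 * g' 8 10];
      [::]; [::]; [::];
      [:: o; o; o; o; o; o; o; o; o; 4 * (g' 7 7 + g' 11 11)];
      [::];
      [:: o; o; o; o; o; o; o; o; o; o; o; 4 * g' 10 10]] i.-1) j.-1.
exists f, b; split.
  apply/row_nth_eq0 => //; rewrite /f /b /=.
  by repeat (apply/andP; split) => //; apply/eqP; field.
move=> C; rewrite quad_F1 weight_formE /sym_sum unlock /wre /wim /modulus_seq /=.
rewrite /f /b /g' /=.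
by field.
Qed.

Lemma weight_form_F2 b d : exists h, forall C,
  quad (block_mx 0 (D_mx d) (D_mx d)^T (B2_mx b)) C
  = weight_form (fun _ _ => 0) h C.
Proof.
pose b' i j := b i%N j%N; pose d' i j := d i%N j%N.
(* Rows start at [j = 5] and columns at [l = 6]. Truncated subtraction sends smaller indices to the
   first row or column, where they contribute nothing: imaginary parts vanish in weight 0, the term
   at [(5, 5)] cancels, and the later rows start with 0 or are empty. *)
pose h j l : R := nth 0 (nth [::]
  [:: [:: b' 4 5 - b' 1 8; - b' 1 5]; [:: 0; - b' 1 8 - b' 4 5]; [::];
      [:: 0; 0; 0; d' 1 3; d' 1 12]; [:: 0; 0; 0; 0; - d' 4 12]] (j - 5)%N) (l - 6)%N.
exists h => C; rewrite quad_F2 weight_formE /rows_sum /sym_sum unlock.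
by rewrite /wre /wim /modulus_seq /h /b' /d' /=; field.
Qed.

Lemma F2_weight_form h : exists b d, forall C,
  quad (block_mx 0 (D_mx d) (D_mx d)^T (B2_mx b)) C
  = weight_form (fun _ _ => 0) h C.
Proof.
pose H j l : R := h j%N l%N - h l%N j%N.
(* Only [(1, 5)], [(1, 8)], [(4, 5)] are read in [b], and [(1, 3)], [(1, 12)], [(4, 12)] in [d], so
   tests on single indices tell them apart. The values solve the system given by the table in
   [weight_form_F2]. *)
exists (fun i j => if j == 8%N then - (H 5 6 + H 6 7) / 2 else
                   if i == 4%N then (H 5 6 - H 6 7) / 2 else - H 5 7).
exists (fun i j => if j == 3%N then H 8 9 else
                   if i == 1%N then H 8 10 else - H 9 10).
move=> C; rewrite quad_F2 weight_formE /rows_sum /sym_sum unlock.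
by rewrite /wre /wim /modulus_seq /H /=; field.
Qed.

Lemma weight_form_split g h C :
  weight_form g h C = weight_form g (fun _ _ => 0) C + weight_form (fun _ _ => 0) h C.
Proof.
rewrite -big_split; apply: eq_bigr => j _; rewrite -big_split.
by apply: eq_bigr => l _ /=; ring.
Qed.

End Matrices.

(** * Dimensions of the matrix families and independence of the conditions *)

Ltac solve_zeros :=
  rewrite /= ?eqxx ?andbT -?andbA /=;
  repeat (case/andP => /eqP ?); try (move/eqP => ?);
  repeat (apply/andP; split); apply/eqP; first [assumption | lra].

Section Dimensions.
Variable R : realType.
Implicit Types (f b d : nat -> nat -> R) (x y : nat * nat -> R).

Lemma in_eq0 (I : eqType) (s : seq I) (x : I -> R) :
  {in s, forall i, x i = 0} <-> all (fun i => x i == 0) s.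
Proof. by split=> [x0|/allP x0 i /x0/eqP //]; apply/allP => i /x0 ->. Qed.

Definition A_pairs : seq (nat * nat) :=
  [:: (1, 1); (1, 2); (1, 3); (1, 4); (1, 5); (1, 6); (1, 7); (1, 8); (1, 9);
      (3, 3); (3, 4); (3, 6); (3, 7); (3, 9);
      (4, 4); (4, 5); (4, 6); (4, 7); (4, 8); (4, 9);
      (6, 6); (6, 7); (6, 9); (7, 7); (7, 8); (7, 9); (9, 9)]%N.

Lemma dim_A : has_dim (range (@A_mx R)) 27.
Proof.
apply: (@has_dim_param R _ _ A_pairs (fun x => A_mx (fun i j => x (i, j)))) => //.
- by move=> a x y; rewrite /A_mx -sym_mx_lin.
- by move=> x; rewrite sym_mx_eq0 // in_eq0; split; solve_zeros.
- move=> v; split=> [[f _ <-]|[x ->]]; last by eexists.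
  by exists (fun p => f p.1 p.2).
Qed.

Definition B1_pairs : seq (nat * nat) :=
  [:: (1, 1); (1, 4); (1, 7); (1, 10); (3, 3); (3, 6); (3, 12);
      (4, 4); (4, 7); (4, 10); (5, 5); (5, 11); (6, 6); (6, 9); (6, 12);
      (10, 10); (12, 12)]%N.

Lemma dim_B1 : has_dim (range (@B1_mx R)) 17.
Proof.
apply: (@has_dim_param R _ _ B1_pairs (fun x => B1_mx (fun i j => x (i, j)))) => //.
- by move=> a x y; rewrite /B1_mx -sym_mx_lin // /lincomb /= !mulr0 !addr0.
- by move=> x; rewrite sym_mx_eq0 // in_eq0; split; solve_zeros.
- move=> v; split=> [[f _ <-]|[x ->]]; last by eexists.
  by exists (fun p => f p.1 p.2).
Qed.

Definition B2_pairs : seq (nat * nat) := [:: (1, 5); (1, 8); (4, 5)]%N.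

Lemma B2_mx_lin a b b' :
  B2_mx (fun i j => a * b i j + b' i j) = a *: B2_mx b + B2_mx b'.
Proof.
rewrite /B2_mx -sym_mx_lin // /lincomb /= !mulr0 !addr0.
by congr (sym_mx _ _); do ![congr (_ :: _)]; ring.
Qed.

Lemma dim_B2 : has_dim (range (@B2_mx R)) 3.
Proof.
apply: (@has_dim_param R _ _ B2_pairs (fun x => B2_mx (fun i j => x (i, j)))) => //.
- by move=> a x y; apply: B2_mx_lin.
- by move=> x; rewrite sym_mx_eq0 // in_eq0; split; solve_zeros.
- move=> v; split=> [[f _ <-]|[x ->]]; last by eexists.
  by exists (fun p => f p.1 p.2).
Qed.

Definition D_pairs : seq (nat * nat) := [:: (1, 3); (1, 12); (4, 12)]%N.

Lemma D_mx_lin a b b' :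
  D_mx (fun i j => a * b i j + b' i j) = a *: D_mx b + D_mx b'.
Proof.
rewrite /D_mx -rows_mx_lin // /lincomb /= !mulr0 !addr0.
by congr (rows_mx _ _ _); do ![congr (_ :: _)]; ring.
Qed.

Lemma dim_D : has_dim (range (@D_mx R)) 3.
Proof.
apply: (@has_dim_param R _ _ D_pairs (fun x => D_mx (fun i j => x (i, j)))) => //.
- by move=> a x y; apply: D_mx_lin.
- by move=> x; rewrite rows_mx_eq0 // in_eq0; split; solve_zeros.
- move=> v; split=> [[f _ <-]|[x ->]]; last by eexists.
  by exists (fun p => f p.1 p.2).
Qed.

(* Each of the 15 conditions has an entry of its own, with coefficient +-1 and
   absent from the other conditions: f i 9 for i = 3, 4, 6, 7, 9 and the ten
   entries of b computed by solve_b. *)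
Definition solve_f (x : bool * (nat * nat) -> R) (i j : nat) : R :=
  let f i j := x (true, (i, j)) in
  if j == 9%N then nth 0
    [:: f 0 9; f 1 9; f 2 9; 2 * f 1 3 - f 3 6; f 1 4 + f 1 5 - f 4 6; f 5 9;
        2 * f 1 1 + 2 * f 1 2 - 2 * f 1 9 - f 6 6; f 1 7 + f 1 8 - f 6 7; f 8 9;
        2 * f 1 1 + 2 * f 1 2 - 4 * f 1 6 + f 6 6] i
  else f i j.

Definition solve_b (x : bool * (nat * nat) -> R) (i j : nat) : R :=
  let f i j := x (true, (i, j)) in let b i j := x (false, (i, j)) in
  if i == 3%N then
    if j == 3%N then 2 * f 4 4 - 2 * f 4 5
    else if j == 6%N then - 2 * f 1 4 + 2 * f 1 5 else 2 * f 4 7 - 2 * f 4 8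
  else if i == 6%N then
    if j == 6%N then 4 * f 1 1 - 2 * f 1 6 - 2 * f 1 9
    else if j == 9%N then - 4 * f 1 2 + 2 * f 1 6 + 2 * f 1 9
    else - 2 * f 1 7 + 2 * f 1 8
  else if i == 12%N then 2 * f 7 7 - 2 * f 7 8
  else if (i, j) == (4, 10)%N then b 4 7 - b 1 4
  else if (i, j) == (10, 10)%N then b 1 1 - 2 * b 1 7 + b 5 5
  else if (i, j) == (5, 11)%N then b 5 5 - b 1 1 - b 1 10
  else b i j.

(** Of the 27 + 17 entries, 15 are solved for and 29 remain. The tag is [true] for entries of [f]
    and [false] for entries of [b]. *)
Definition F1_free : seq (bool * (nat * nat)) :=
  [seq (true, p) | p <-
    [:: (1, 1); (1, 2); (1, 3); (1, 4); (1, 5); (1, 6); (1, 7); (1, 8); (1, 9);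
        (3, 3); (3, 4); (3, 6); (3, 7); (4, 4); (4, 5); (4, 6); (4, 7); (4, 8);
        (6, 6); (6, 7); (7, 7); (7, 8)]%N] ++
  [seq (false, p) | p <-
    [:: (1, 1); (1, 4); (1, 7); (1, 10); (4, 4); (4, 7); (5, 5)]%N].

Definition F1_mx (x : bool * (nat * nat) -> R) : 'M[R]_(9 + 12) :=
  block_mx (A_mx (solve_f x)) 0 0 (B1_mx (solve_b x)).

Lemma conditions_solved (x : bool * (nat * nat) -> R) :
  conditions (solve_f x) (solve_b x) = 0.
Proof.
apply/row_nth_eq0 => //; rewrite /solve_f /solve_b /=.
by repeat (apply/andP; split) => //; apply/eqP; ring.
Qed.

Lemma F1_mx_solved f b : conditions f b = 0 ->
  let x p := if p.1 then f p.2.1 p.2.2 else b p.2.1 p.2.2 in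
  block_mx (A_mx f) 0 0 (B1_mx b) = F1_mx x.
Proof.
move=> /row_nth_eq0 -/(_ erefl) /=.
do 15![case/andP => /eqP ?]; move=> _.
by rewrite /F1_mx; congr (block_mx _ _ _ _); rewrite /A_mx /B1_mx /solve_f /solve_b /=;
  congr (sym_mx _ _); do ![congr (_ :: _)]; lra.
Qed.

Lemma F1_mx_lin a (x y : bool * (nat * nat) -> R) :
  F1_mx (fun p => a * x p + y p) = a *: F1_mx x + F1_mx y.
Proof.
rewrite /F1_mx scale_block_mx add_block_mx !scaler0 !addr0 /A_mx /B1_mx.
rewrite -!sym_mx_lin // /lincomb /solve_f /solve_b /= !mulr0 !addr0.
by congr (block_mx (sym_mx _ _) _ _ (sym_mx _ _));
  do ![congr (_ :: _)]; ring.
Qed.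

Lemma dim_F1 : has_dim (@F1_family R) 29.
Proof.
apply: (@has_dim_param R _ _ F1_free F1_mx) => //; first exact: F1_mx_lin.
- move=> x; rewrite in_eq0 /F1_mx; split.
    move/eqP; rewrite block_mx_eq0 => /and4P[/eqP + _ _ /eqP].
    rewrite !sym_mx_eq0 // => h1 h2.
    have := introT andP (conj h1 h2).
    rewrite /solve_f /solve_b; solve_zeros.
  move=> h.
  have -> : A_mx (solve_f x) = 0.
    by apply/sym_mx_eq0 => //; move: h; rewrite /solve_f; solve_zeros.
  have -> : B1_mx (solve_b x) = 0.
    by apply/sym_mx_eq0 => //; move: h; rewrite /solve_b; solve_zeros.
  by rewrite block_mx0.
- move=> v; split=> [[f [b [fb ->]]]|[x ->]].
    by eexists; apply: F1_mx_solved.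
  by do 2 eexists; split; first exact: conditions_solved.
Qed.

Definition F2_free : seq (bool * (nat * nat)) :=
  [seq (true, p) | p <- B2_pairs] ++ [seq (false, p) | p <- D_pairs].

Definition F2_mx (x : bool * (nat * nat) -> R) : 'M[R]_(9 + 12) :=
  let D := D_mx (fun i j => x (false, (i, j))) in
  block_mx 0 D D^T (B2_mx (fun i j => x (true, (i, j)))).

Lemma dim_F2 : has_dim (@F2_family R) 6.
Proof.
apply: (@has_dim_param R _ _ F2_free F2_mx) => //.
- move=> a x y; rewrite /F2_mx scale_block_mx add_block_mx scaler0 addr0.
  by rewrite B2_mx_lin D_mx_lin linearP.
- move=> x; rewrite in_eq0 /F2_mx; split.
    move/eqP; rewrite block_mx_eq0 => /and4P[_ /eqP + _ /eqP].
    rewrite sym_mx_eq0 // rows_mx_eq0 // => h1 h2.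
    have := introT andP (conj h1 h2).
    solve_zeros.
  move=> h.
  have -> : D_mx (fun i j => x (false, (i, j))) = 0.
    by apply/rows_mx_eq0 => //; move: h; solve_zeros.
  have -> : B2_mx (fun i j => x (true, (i, j))) = 0.
    by apply/sym_mx_eq0 => //; move: h; solve_zeros.
  by rewrite trmx0 block_mx0.
- move=> v; split=> [[b [d ->]]|[x ->]]; last by do 2 eexists.
  by exists (fun p => if p.1 then b p.2.1 p.2.2 else d p.2.1 p.2.2).
Qed.

(** The conditions, as a linear map of [(f, b)], reach every unit vector. Evaluating a linear
    relation there isolates each coefficient. *)
Lemma conditions_free (a : 'I_15 -> R) :
  (forall f b, \sum_k a k * conditions f b 0 k = 0) -> forall k, a k = 0.
Proof.
move=> a0 k.
have [f [b fb]] : exists f b, conditions f b = delta_mx 0 k.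
  (* Only the entries private to one condition are nonzero: [y n] where the entry has coefficient
     -1, and [- y n] where it has coefficient 1. *)
  pose y n := - (delta_mx 0 k : 'rV[R]_15) 0 (inord n).
  exists (fun i j => nth 0 (nth [::]
    [:: [::]; [::]; [::]; nseq 9 0 ++ [:: y 2]; nseq 9 0 ++ [:: y 3]; [::];
        nseq 9 0 ++ [:: y 1]; nseq 9 0 ++ [:: y 4]; [::]; nseq 9 0 ++ [:: y 0]] i) j).
  exists (fun i j => nth 0 (nth [::]
    [:: [::]; [::]; [::]; nseq 3 0 ++ [:: y 5; 0; 0; - y 6; 0; 0; 0; 0; 0; y 7];
        nseq 10 0 ++ [:: - y 12]; nseq 11 0 ++ [:: - y 14];
        nseq 6 0 ++ [:: y 8; 0; 0; - y 9; 0; 0; - y 10]; [::]; [::]; [::];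
        nseq 10 0 ++ [:: y 13]; [::]; nseq 12 0 ++ [:: y 11]] i) j).
  apply/rowP => n; rewrite [LHS]mxE.
  have -> : (delta_mx 0 k : 'rV[R]_15) 0 n = - y n by rewrite /y opprK inord_val.
  case: n => n ltn /=; do 15?[case: n ltn => [|n] ltn //]; rewrite /=; ring.
have := a0 f b; rewrite fb (bigD1 k) //= mxE !eqxx mulr1 big1 ?addr0 //.
by move=> j jk; rewrite mxE eqxx (negPf jk) mulr0.
Qed.

End Dimensions.

(** * The invariant forms as the injective image of the two families *)

Section QuadraticForms.
Variable R : realType.
Implicit Types (C D : elasticity R) (F G : 'M[R]_(9 + 12)) (f b d : nat -> nat -> R).

Lemma moduli_lin a C D : moduli (a *: C + D) = a *: moduli C + moduli D.
Proof.
apply/colP => n.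
have -> : (a *: moduli C + moduli D) n 0 = a * moduli C n 0 + moduli D n 0.
  by rewrite mxE [X in X + _]mxE.
by rewrite !moduliE /= modulus_lin.
Qed.

Lemma moduli_of_moduli (v : 'cV[R]_(9 + 12)) :
  moduli (of_moduli (fun n => v (inord n) 0)) = v.
Proof.
apply/colP => n; rewrite moduliE /=.
have -> : v n 0 = v (inord n) 0 by rewrite inord_val.
move: (ltn_ord n); move: (nat_of_ord n) => k.
by do 21?[case: k => [|k]; first by rewrite /= modulus_of_moduli].
Qed.

Definition polar F C D : R^o := ((moduli C)^T *m F *m moduli D) 0 0.

Fact polar_bilinear F : bilinear_for *:%R *:%R (polar F).
Proof.
split=> [D a C C'|C a D D']; rewrite /polar moduli_lin.
  by rewrite linearP /= !mulmxDl -!scalemxAl !mxE.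
by rewrite mulmxDr -scalemxAr !mxE.
Qed.

HB.instance Definition _ F := bilinear_isBilinear.Build R
  (elasticity R) (elasticity R) R^o *:%R *:%R (polar F) (polar_bilinear F).

Lemma quad_quadratic F : quadratic_form (quad F : elasticity R -> R^o).
Proof. by exists (polar F). Qed.

Lemma quad_lin a F G C : quad (a *: F + G) C = a * quad F C + quad G C.
Proof. by rewrite /quad mulmxDr mulmxDl -scalemxAr -scalemxAl !mxE. Qed.

Lemma quadD F G C : quad (F + G) C = quad F C + quad G C.
Proof. by have := quad_lin 1 F G C; rewrite scale1r mul1r. Qed.

(** Every column vector is the vector of moduli of some tensor, so the symmetric bilinear form of
    [F] vanishes on the diagonal. By polarisation it vanishes on pairs of basis vectors, where its
    values are the entries of [F]. *)
Lemma quad_eq0 F : F^T = F -> (forall C, quad F C = 0) -> F = 0.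
Proof.
move=> symF quad0.
pose B (u v : 'cV_(9 + 12)) := (u^T *m F *m v) 0 0.
have B0 u : B u u = 0 by have := quad0 (of_moduli (fun n => u (inord n) 0));
  rewrite /quad moduli_of_moduli.
have BC u v : B u v = B v u.
  rewrite /B !bilinear_mxE exchange_big; apply: eq_bigr => i _.
  by apply: eq_bigr => j _; rewrite -{1}symF mxE [X in _ * X]mulrC.
apply/matrixP => i j; rewrite [RHS]mxE.
have -> : F i j = B (delta_mx i 0) (delta_mx j 0).
  by rewrite /B trmx_delta -rowE -colE !mxE.
have := B0 (delta_mx i 0 + delta_mx j 0).
have BD u v w : B (u + v) w = B u w + B v w.
  by rewrite /B [(u + v)^T]raddfD /= !mulmxDl mxE.
rewrite BD !(BC _ (_ + _)) !BD !B0 (BC (delta_mx j 0)); lra.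
Qed.

Lemma tr_sym_mx n (s : seq (seq R)) : (sym_mx n s)^T = sym_mx n s.
Proof. by apply/matrixP => i j; rewrite !mxE minnC maxnC. Qed.

Lemma F1_F2_quad_free F1 F2 : F1_family F1 -> F2_family F2 ->
  (quad (F1 + F2) : elasticity R -> R^o) = 0 -> F1 = 0 /\ F2 = 0.
Proof.
move=> [f [b [_ ->]]] [b' [d ->]] q0.
set F := _ + _ in q0.
have /quad_eq0 : F^T = F.
  by rewrite /F linearD /= !tr_block_mx !tr_sym_mx trmxK !trmx0.
move=> /(_ (fun C => congr1 (@^~ C) q0)) /eqP; rewrite /F add_block_mx.
rewrite block_mx_eq0 addr0 !add0r => /and4P[/eqP -> /eqP -> _ B0].
(* The blocks [A_mx f] and [D_mx d] stand alone and are already 0. [B1_mx] and [B2_mx] share a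
   block, but their possibly nonzero entries occupy disjoint positions. *)
suff [-> ->] : B1_mx b = 0 /\ B2_mx b' = 0 by rewrite trmx0 !block_mx0.
have {}B0 : 1 *: B1_mx b + B2_mx b' = 0 by rewrite scale1r; apply/eqP.
rewrite -sym_mx_lin // sym_mx_eq0 // in B0.
rewrite /= !(mul1r, addr0, add0r) in B0.
by split; apply/sym_mx_eq0 => //; move: B0; solve_zeros.
Qed.

Lemma F_family_invariant F1 F2 : F1_family F1 -> F2_family F2 ->
  invariant_under (@SO2 R) (quad (F1 + F2) : elasticity R -> R^o).
Proof.
move=> [f [b [/weight_form_F1 F1E ->]]] [b' [d ->]] Q C /SO2P[c [s [cs ->]]].
have [h F2E] := weight_form_F2 b' d.
by rewrite !quadD !F1E !F2E !weight_form_act.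
Qed.

Lemma invariant_F_family (phi : elasticity R -> R^o) :
  quadratic_form phi -> invariant_under (@SO2 R) phi ->
  exists F1 F2, [/\ F1_family F1, F2_family F2 & forall C, phi C = quad (F1 + F2) C].
Proof.
move=> quad_phi /(invariant_weight_form quad_phi)[g [h phiE]].
have [f [b [fb F1E]]] := F1_weight_form g.
have [b' [d F2E]] := F2_weight_form h.
do 2 eexists; split; [by exists f, b; split|by exists b', d|move=> C].
by rewrite quadD F1E F2E phiE weight_form_split.
Qed.

Lemma dim_quadratic_invariants : has_dim (quadratic_invariants (@SO2 R)) 35.
Proof.
apply: (@has_dim_image_add R _ _ (@F1_family R) (@F2_family R) _
  (fun F => quad F : elasticity R -> R^o) 29 6); last exact: dim_F2; last exact: dim_F1.
- by move=> a F G; apply: funext => C; apply: quad_lin.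
- exact: F1_F2_quad_free.
- move=> phi; split=> [[quad_phi /(invariant_F_family quad_phi)]|].
    by move=> [F1 [F2 [F1P F2P phiE]]]; exists F1, F2; split=> //; apply: funext.
  move=> [F1 [F2 [F1P F2P ->]]]; split; first exact: quad_quadratic.
  exact: F_family_invariant.
Qed.

End QuadraticForms.

Theorem theorem2 (R : realType) :
  (forall phi : elasticity R -> R^o, quadratic_form phi ->
     (invariant_under (@SO2 R) phi <->
      exists F1 F2 : 'M[R]_(9 + 12), [/\ F1_family F1, F2_family F2 &
        forall C : elasticity R,
          phi C = ((moduli C)^T *m (F1 + F2) *m moduli C) 0 0])) /\
  [/\ has_dim (range (@A_mx R)) 27,
      has_dim (range (@B1_mx R)) 17,
      has_dim (range (@B2_mx R)) 3 &
      has_dim (range (@D_mx R)) 3] /\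
  (forall a : 'I_15 -> R,
     (forall f b : nat -> nat -> R, \sum_k a k * conditions f b 0 k = 0) ->
     forall k, a k = 0) /\
  has_dim (@F1_family R) 29 /\
  has_dim (@F2_family R) 6 /\
  has_dim (quadratic_invariants (@SO2 R)) 35.
Proof.
split.
  move=> phi quad_phi; split=> [|[F1 [F2 [F1P F2P phiE]]]].
    exact: invariant_F_family.
  by rewrite (_ : phi = quad (F1 + F2)); [exact: F_family_invariant|exact: funext].
split; first by split; [exact: dim_A|exact: dim_B1|exact: dim_B2|exact: dim_D].
split; first exact: conditions_free.
by split; [exact: dim_F1|split; [exact: dim_F2|exact: dim_quadratic_invariants]].
Qed.
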